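(* Let $\psi\in H^1_{\mathrm{per}}(0,1)\cap L^\infty(0,1)$ (extended one-periodically to $\mathbb R$) with $\|\psi'\|_{L^2(0,1)}>0$. Let $\varepsilon_n\downarrow 0$ be a sequence of positive numbers with $\varepsilon_n^{-1}\in\mathbb N$ for every $n$, and let $r_n>0$ with $r_n\to0$. Define $R_n(x)=r_n\,\psi(x/\varepsilon_n)$ for $x\in\mathbb R$. Then for every $n$ $$\|R_n\|_{L^\infty(\mathbb R)}\le r_n\|\psi\|_{L^\infty},\qquad \|R_n'\|_{L^2(0,1)}=\frac{r_n}{\varepsilon_n}\,\|\psi'\|_{L^2(0,1)}.$$ Consequently $\|R_n\|_{L^\infty(\mathbb R)}\to0$, while $\|R_n'\|_{L^2(0,1)}$ remains $O(1)$ when $r_n\asymp\varepsilon_n$, and $\|R_n'\|_{L^2(0,1)}\to\infty$ whenever $r_n/\varepsilon_n\to\infty$. In particular, if $r_n=\varepsilon_n^\alpha$ with $0<\alpha<1$, then $$\|R_n\|_{L^\infty(\mathbb R)}=O(\varepsilon_n^\alpha),\qquad \|R_n'\|_{L^2(0,1)}\asymp\varepsilon_n^{\alpha-1}\longrightarrow\infty .$$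
   Context: $H^1_{\mathrm{per}}(0,1)$ denotes the one-periodic functions on $\mathbb R$ that are locally in $H^1$ (restricted to one period); primes denote weak derivatives. $A_n\asymp B_n$ means that there are constants $0<c\le C<\infty$ independent of $n$ with $cB_n\le A_n\le CB_n$. *)

(* Defs.v *)
From HB Require Import structures.
From mathcomp Require Import all_boot all_order all_algebra.
From mathcomp Require Import all_classical all_reals all_analysis.

Set Implicit Arguments.
Unset Strict Implicit.
Unset Printing Implicit Defensive.

Import Order.TTheory GRing.Theory Num.Theory.
Import numFieldNormedType.Exports.

Local Open Scope classical_set_scope.
Local Open Scope ring_scope.

Definition unit_itv (R : realType) : set R := `]0, 1[.
Arguments unit_itv : clear implicits.

(* [f \_ D] extends [f] outside [D] by the default point of [R], which is 0. *)
Definition Lnorm_on (R : realType) (D : set R) (p : \bar R) (f : R -> R) :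
    \bar R :=
  'N[@lebesgue_measure R]_p [EFin \o (f \_ D)].

Definition Lfun_on (R : realType) (D : set R) (p : \bar R) (f : R -> R) : Prop :=
  f \_ D \in Lfun (@lebesgue_measure R) p.

Definition L2loc (R : realType) (f : R -> R) : Prop :=
  forall K : set R, compact K -> Lfun_on K 2%:E f.

(* The space C_c^\infty(R). *)
Definition test_function (R : realType) (phi : R -> R) : Prop :=
  (forall (k : nat) (x : R), derivable (derive1n k phi) x 1) /\
  compact (closure [set x | phi x != 0]).

Definition is_weak_derive (R : realType) (f g : R -> R) : Prop :=
  [/\ locally_integrable [set: R] f, locally_integrable [set: R] g &
      forall phi : R -> R, test_function phi ->
        (\int[lebesgue_measure]_x (f x * derive1 phi x) =
         - \int[lebesgue_measure]_x (g x * phi x))%R].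

Definition weakly_derivable (R : realType) (f : R -> R) : Prop :=
  exists g : R -> R, is_weak_derive f g.

(* A representative of the weak derivative, which is unique up to equality
   almost everywhere; meaningful only when [weakly_derivable f]. *)
Definition weak_derive (R : realType) (f : R -> R) : R -> R :=
  get (is_weak_derive f).

Definition H1loc (R : realType) (f : R -> R) : Prop :=
  [/\ L2loc f, weakly_derivable f & L2loc (weak_derive f)].

(* Elements of H^1 are functions up to equality almost everywhere, so
   periodicity of a representative is required almost everywhere only. *)
Definition H1per (R : realType) (f : R -> R) : Prop :=
  H1loc f /\ {ae @lebesgue_measure R, forall x, f (x + 1) = f x}.

(* A_n = O(B_n) and A_n \asymp B_n, with constants independent of n; stated in
   \bar R so that the bounds include finiteness of the norms. *)
Definition is_O (R : realType) (A B : nat -> \bar R) : Prop :=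
  exists2 C : R, 0 < C & forall n, (A n <= C%:E * B n)%E.

Definition asymp (R : realType) (A B : nat -> \bar R) : Prop :=
  exists c C : R, [/\ 0 < c, c <= C &
    forall n, (c%:E * B n <= A n)%E /\ (A n <= C%:E * B n)%E].

(* Main.v *)
Require Import Defs.
From HB Require Import structures.
From mathcomp Require Import all_boot all_order all_algebra.
From mathcomp Require Import all_classical all_reals all_analysis.
From mathcomp Require Import measurable_realfun ess_sup_inf ring lra.

(** The function [R_n] is [r_n psi (k x)] with [k = 1 / eps_n] a positive
    integer, so everything follows from the behaviour of weak derivatives and
    norms under the dilation [x |-> k x] and from periodicity.

    Sup norm: the dilation maps null sets to null sets, and a bound of
    [|psi|] that holds almost everywhere on a period holds almost everywhere
    on the line ([Lnorm_ony_periodic]).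

    Derivative: substituting an affine map in the identity that defines weak
    derivatives gives the chain rule [is_weak_derive_affine].  Hence
    [r_n k psi' (k x)] is a weak derivative of [R_n]; being unique up to null
    sets ([weak_derive_unique]), it has the same norm as [weak_derive (R_n)].
    Uniqueness also makes [psi'] periodic ([weak_derive_periodic]), since the
    unit translate of [psi'] is a weak derivative of the unit translate of
    [psi], which is almost everywhere [psi].  As [x |-> k x] wraps the period
    [k] times around itself, it preserves the mean of periodic functions
    ([integral_dilation_periodic]), and the norm is multiplied by [r_n k]
    exactly ([Lnorm_on2_dilation]).

    Uniqueness rests on an ample supply of test functions.  The products
    [exp (-1/(m (x - a))) exp (-1/(m (b - x)))], cut off outside [(a, b)],
    are smooth and increase to the indicator of [(a, b)] as [m] grows.  By
    dominated convergence, functions with the same integral against every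
    test function have the same integral on every interval, and Lebesgue's
    differentiation theorem concludes ([test_function_ae_eq]).

    The asymptotic statements are then elementary, because
    [0 < ||psi'|| < +oo] and [||psi|| < +oo]. *)

Set Implicit Arguments.
Unset Strict Implicit.
Unset Printing Implicit Defensive.

Import Order.TTheory GRing.Theory Num.Theory.
Import numFieldNormedType.Exports.

Local Open Scope classical_set_scope.
Local Open Scope ring_scope.

(** * Smooth bump functions *)

(** The polynomial in [1/y] makes the family stable under differentiation. *)
Definition flat (R : realType) (p : {poly R}) (y : R) : R :=
  if 0 < y then p.[y^-1] * expR (- y^-1) else 0.

Lemma expRN_le_expfN (R : realType) (m : nat) (t : R) : 0 < t ->
  t ^+ m * expR (- t) <= m.+2`!%:R * t ^- 2.
Proof.
move=> t0; have F0 : 0 < (m.+2`!)%:R :> R by rewrite ltr0n fact_gt0.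
rewrite expRN ler_pdivrMr ?expR_gt0// mulrAC ler_pdivlMr ?exprn_gt0//.
rewrite -exprD addn2 mulrC -ler_pdivrMr//.
by have := expR_ge1Dxn m.+1 (ltW t0); lra.
Qed.

(** A quadratic bound is what makes [flat p] differentiable at [0], with
    derivative [0]; it also covers large [y] because the exponential beats
    [(1/y)^(i+2)] for every [y > 0], not only near [0]. *)
Lemma flat_bound (R : realType) (p : {poly R}) :
  exists2 C : R, 0 < C & forall y, `|flat p y| <= C * y ^+ 2.
Proof.
exists (1 + \sum_(i < size p) `|p`_i| * i.+2`!%:R).
  by rewrite ltr_pwDl// sumr_ge0// => i _; rewrite mulr_ge0.
move=> y; rewrite /flat; case: ifPn => [y0|_]; last first.
  rewrite normr0 mulr_ge0 ?sqr_ge0//.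
  by rewrite addr_ge0 ?sumr_ge0// => i _; rewrite mulr_ge0.
rewrite normrM (ger0_norm (expR_ge0 _)) horner_coef.
apply: (@le_trans _ _ ((\sum_(i < size p) `|p`_i| * i.+2`!%:R) * y ^+ 2));
    last first.
  by rewrite ler_wpM2r ?sqr_ge0// lerDr.
rewrite mulr_suml.
apply: (@le_trans _ _
  ((\sum_(i < size p) `|p`_i| * y^-1 ^+ i) * expR (- y^-1))).
  rewrite ler_wpM2r ?expR_ge0// (le_trans (ler_norm_sum _ _ _))//.
  rewrite ler_sum// => i _.
  by rewrite normrM (@ger0_norm _ (_ ^+ _))// exprn_ge0// invr_ge0 ltW.
rewrite mulr_suml ler_sum// => i _; rewrite -!mulrA ler_wpM2l//.
rewrite (le_trans (expRN_le_expfN _ _)) ?invr_gt0//.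
by rewrite exprVn invrK.
Qed.

Lemma is_derive_flat (R : realType) (p : {poly R}) (y : R) :
  is_derive y 1 (flat p) (flat ('X^2 * (p - p^`())) y).
Proof.
have [y0|y0|->] := ltrgtP y 0.
- rewrite [X in is_derive _ _ _ X](_ : _ = 0); last first.
    by rewrite /flat ltNge (ltW y0).
  apply: (@near_eq_is_derive _ _ _ (cst 0)).
  near=> z; rewrite /flat/=; case: ifPn => // z0.
  suff : z < 0 by move=> /(lt_trans z0); rewrite ltxx.
  by near: z; apply: lt_nbhsl.
- rewrite [X in is_derive _ _ _ X]/flat y0.
  apply: (@near_eq_is_derive _ _ _
     (((horner p) \o (fun z => z^-1)) * (expR \o (fun z => - z^-1)))).
    near=> z; rewrite /flat ifT//.
    by near: z; apply: lt_nbhsr.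
  have yn0 : y != 0 by rewrite gt_eqF.
  have dV : is_derive y 1 (fun z : R => z^-1) (- y ^- 2).
    apply: is_derive_eq; first exact: (@is_deriveV _ id y 1 1).
    by rewrite /GRing.scale/= mulr1.
  apply: is_derive_eq.
  rewrite /GRing.scale/= !hornerE/= exprVn.
  by ring.
(* At the junction the difference quotient is at most C |h|. *)
- rewrite [X in is_derive _ _ _ X]/flat ltxx.
  have [C C0 bC] := flat_bound p.
  have flat0 : flat p 0 = 0 by rewrite /flat ltxx.
  suff h : (fun h : R => h^-1 *: (flat p (h *: 1 + 0) - flat p 0)) @ 0^' --> 0.
    by apply: DeriveDef; [exact: (cvgP _ h)|exact: cvg_lim].
  apply/cvgrPdist_le => e e0; near=> h.
  have hn0 : h != 0 by near: h; exact: nbhs_dnbhs_neq.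
  rewrite sub0r normrN flat0 subr0 addr0 /GRing.scale/= mulr1 normrM normfV.
  rewrite mulrC ler_pdivrMr ?normr_gt0// (le_trans (bC h))//.
  rewrite -real_normK ?num_real// expr2 mulrA ler_wpM2r// -ler_pdivlMl//.
  by near: h; apply: dnbhs0_le; rewrite mulr_gt0 ?invr_gt0.
Unshelve. all: by end_near. Qed.

Lemma is_derive_affine (R : realType) (a b x d : R) (f : R -> R) :
  is_derive (a * x + b) 1 f d ->
  is_derive x 1 (fun y => f (a * y + b)) (a * d).
Proof.
move=> df.
have da : is_derive x 1 (fun x => a * x + b) a.
  rewrite [X in is_derive _ _ X](_ : _ = a \*o id + cst b)//.
  apply: is_derive_eq.
  by rewrite addr0 /GRing.scale/= mulr1.
by rewrite mulrC; exact: (@is_derive1_comp _ f _ x _ _ df).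
Qed.

(** Smoothness follows from membership in a class of functions that is closed
    under differentiation: this avoids a Leibniz formula for higher
    derivatives of products. *)
Inductive flat_algebra (R : realType) : (R -> R) -> Prop :=
| flat_affine (p : {poly R}) (c d : R) :
    flat_algebra (fun x => flat p (c * x + d))
| flat_algebraD (f g : R -> R) :
    flat_algebra f -> flat_algebra g -> flat_algebra (f + g)
| flat_algebraM (f g : R -> R) :
    flat_algebra f -> flat_algebra g -> flat_algebra (f * g).

Lemma flat_algebra_derive (R : realType) (f : R -> R) : flat_algebra f ->
  exists2 g : R -> R, flat_algebra g & forall x : R, is_derive x 1 f (g x).
Proof.
elim=> [p c d|{}f g _ [f' Af df] _ [g' Ag dg]|].
- exists (fun x => flat ('X^2 * (p - p^`()) * c%:P) (c * x + d)).
    exact: flat_affine.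
  move=> x; apply: is_derive_eq.
    by apply: is_derive_affine; exact: is_derive_flat.
  by rewrite /flat; case: ifPn => _; rewrite ?mulr0// !hornerE/=; ring.
- exists (f' + g'); first exact: flat_algebraD.
  by move=> x; apply: is_deriveD.
- move=> {}f g Sf [f' Af df] Sg [g' Ag dg].
  exists (f * g' + g * f'); first by apply: flat_algebraD; apply: flat_algebraM.
  by move=> x; apply: is_deriveM.
Qed.

Lemma flat_algebra_smooth (R : realType) (f : R -> R) (k : nat) (x : R) :
  flat_algebra f -> derivable (derive1n k f) x 1.
Proof.
move=> Sf; suff {x} /flat_algebra_derive[g _ dg] : flat_algebra (derive1n k f).
  by have [] := dg x.
elim: k f Sf => [//|k IH] f /flat_algebra_derive[g Sg dg].
rewrite derive1Sn (_ : f^`()%classic = g); first exact: IH.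
by apply/funext => x; rewrite derive1E (@derive_val _ _ _ _ _ _ _ (dg x)).
Qed.

(** Scaling the argument of [exp (-1/y)] by [n + 1] tends to [1] for [y > 0]
    and keeps the value [0] for [y <= 0], so these bumps approximate the
    indicator of [(a, b)] without changing their support. *)
Definition bump (R : realType) (a b : R) (n : nat) : R -> R :=
  fun x => flat 1 (n.+1%:R * (x - a)) * flat 1 (n.+1%:R * (b - x)).

Lemma flat1 (R : realType) (y : R) :
  flat 1 y = if 0 < y then expR (- y^-1) else 0.
Proof. by rewrite /flat hornerC mul1r. Qed.

Lemma flat1_itv (R : realType) (y : R) : 0 <= flat 1 y <= 1.
Proof.
rewrite flat1; case: ifPn => y0; rewrite ?lexx ?ler01// expR_ge0/=.
by rewrite expR_le1 oppr_le0 invr_ge0 ltW.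
Qed.

Lemma bump_itv (R : realType) (a b : R) n x : 0 <= bump a b n x <= 1.
Proof.
have /andP[u0 u1] := flat1_itv (n.+1%:R * (x - a)).
have /andP[v0 v1] := flat1_itv (n.+1%:R * (b - x)).
by rewrite mulr_ge0//= mulr_ile1.
Qed.

Lemma bump_eq0 (R : realType) (a b : R) n x :
  x \notin `]a, b[ -> bump a b n x = 0.
Proof.
rewrite in_itv/= negb_and -!leNgt /bump !flat1.
rewrite !pmulr_rgt0 ?ltr0n// !subr_gt0 !ltNge.
by move=> /orP[->|->]; rewrite ?mul0r ?mulr0.
Qed.

Lemma bump_test_function (R : realType) (a b : R) n :
  test_function (bump a b n).
Proof.
split=> [k x|].
  apply: flat_algebra_smooth.
  rewrite (_ : bump a b n = (fun x => flat 1 (n.+1%:R * x + - (n.+1%:R * a))) *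
                       (fun x => flat 1 (- n.+1%:R * x + n.+1%:R * b))).
    by apply: flat_algebraM; exact: flat_affine.
  by apply/funext => z; rewrite /bump; congr (flat _ _ * flat _ _); ring.
apply: (@subclosed_compact _ _ `[a, b]).
- exact: closed_closure.
- exact: segment_compact.
- rewrite [X in _ `<=` X](closure_id _).1; last exact: interval_closed.
  apply: closure_subset => x/= /eqP; apply: contra_notT => xab.
  by rewrite bump_eq0//; apply: contra xab; exact: subset_itv_oo_cc.
Qed.

Lemma bump_cvg (R : realType) (a b x : R) :
  bump a b n x @[n --> \oo] --> (\1_(`]a, b[) x : R).
Proof.
have [xab|xab] := boolP (x \in `]a, b[); last first.
  rewrite indicE memNset; last exact/negP.
  by under eq_cvg do rewrite bump_eq0//; exact: cvg_cst.
rewrite indicE mem_set//=.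
have flat_cvg (y : R) : 0 < y -> flat 1 (n.+1%:R * y) @[n --> \oo] --> (1 : R).
  move=> y0.
  under eq_cvg do rewrite flat1 pmulr_lgt0// ltr0n invfM -mulNr.
  have : expR (- (n.+1%:R)^-1 * y^-1) @[n --> \oo] --> expR (- 0 * y^-1).
    apply: (@continuous_cvg _ _ _ _ _ _ expR); first exact: continuous_expR.
    by apply: cvgMl; apply: cvgN; exact: cvg_harmonic.
  by rewrite oppr0 mul0r expR0.
move: xab; rewrite in_itv/= => /andP[ax xb].
rewrite -(mulr1 1).
by apply: cvgM; apply: flat_cvg; rewrite subr_gt0.
Qed.

(** * Uniqueness of weak derivatives *)

Section uniqueness.
Variable R : realType.
Local Notation mu := (@lebesgue_measure R).

Lemma ae_imp (P Q : R -> Prop) : (forall x, P x -> Q x) ->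
  {ae mu, forall x, P x} -> {ae mu, forall x, Q x}.
Proof. exact: (@filterS _ _ (ae_filter_ringOfSetsType mu)). Qed.

Lemma ae_imp2 (P Q S : R -> Prop) : (forall x, P x -> Q x -> S x) ->
  {ae mu, forall x, P x} -> {ae mu, forall x, Q x} -> {ae mu, forall x, S x}.
Proof. exact: (@filterS2 _ _ (ae_filter_ringOfSetsType mu)). Qed.

Lemma locally_integrable_itv (f : R -> R) (i : interval R) (u v : R) :
  locally_integrable [set: R] f -> [set` i] `<=` `[u, v] ->
  mu.-integrable [set` i] (EFin \o f).
Proof.
move=> [mf _ lf] iuv.
apply: (@integrableS _ _ _ mu _ _ _ _ _ iuv) => //.
apply/integrableP; split.
  by apply/measurable_EFinP; exact: measurable_funTS.
by apply: lf => //; exact: segment_compact.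
Qed.

Lemma measurable_test_function (phi : R -> R) : test_function phi ->
  measurable_fun [set: R] phi.
Proof.
move=> [phis _]; apply: continuous_measurable_fun => x.
by apply/differentiable_continuous/derivable1_diffP; exact: (phis 0%N).
Qed.

Lemma measurable_derive1_test_function (phi : R -> R) : test_function phi ->
  measurable_fun [set: R] (derive1 phi).
Proof.
move=> [phis _]; apply: continuous_measurable_fun => x.
by apply/differentiable_continuous/derivable1_diffP; exact: (phis 1%N).
Qed.

(** The bumps are bounded by [1] and vanish off [(a, b)], so [|g|] on
    [(a, b)] dominates. *)
Lemma cvg_Rintegral_bump (g : R -> R) (a b : R) :
  locally_integrable [set: R] g ->
  \int[mu]_x (g x * bump a b n x) @[n --> \oo] --> \int[mu]_(x in `]a, b[) g x.
Proof.
move=> lg; have [mg _ _] := lg.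
have mab : measurable (`]a, b[ : set R) by [].
have gab : mu.-integrable `]a, b[ (EFin \o g).
  by apply: (@locally_integrable_itv _ _ a b) => //; exact: subset_itv_oo_cc.
have E n : \int[mu]_x (g x * bump a b n x) =
    \int[mu]_(x in `]a, b[) (g x * bump a b n x).
  rewrite [RHS]Rintegral_mkcond; apply: eq_Rintegral => x _.
  rewrite patchE; case: ifPn => // /negP; rewrite inE/= => /negP xab.
  by rewrite bump_eq0// mulr0.
under eq_cvg do rewrite E.
have mb n : measurable_fun `]a, b[ (fun x => (g x * bump a b n x)%:E).
  apply/measurable_EFinP; apply: measurable_funTS; apply: measurable_funM => //.
  exact: measurable_test_function (bump_test_function _ _ _).
have bg : {ae mu, forall x, `]a, b[%classic x ->
    (g x * bump a b n x)%:E @[n --> \oo] --> (EFin \o g) x}.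
  apply: aeW => x /= xab; apply: cvg_EFin; first exact: nearW.
  have := @bump_cvg R a b x; rewrite indicE mem_set// => h.
  by have := cvgM (cvg_cst (g x)) h; rewrite mulr1; exact.
have ub : {ae mu, forall x (n : nat), `]a, b[%classic x ->
    (`|(g x * bump a b n x)%:E| <= `|(g x)%:E|)%E}.
  apply: aeW => x /= n xab; rewrite lee_fin normrM.
  have /andP[h0 h1] := bump_itv a b n x.
  by rewrite (ger0_norm h0) ler_piMr.
have mgab : measurable_fun `]a, b[ (EFin \o g).
  by apply/measurable_EFinP; exact: measurable_funTS.
have [ig _ cg] := @dominated_convergence _ _ R mu _ mab _ _ _ mb mgab bg
  (integrable_abse gab) ub.
apply: fine_cvg; rewrite fineK; first exact: cg.
exact: integrable_fin_num.
Qed.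

(** The fundamental lemma of the calculus of variations.  Both functions have
    the same primitive [y |-> \int_(x - 1)^y], whose derivative at a Lebesgue
    point [x] is the value there. *)
Lemma test_function_ae_eq (g1 g2 : R -> R) :
  locally_integrable [set: R] g1 -> locally_integrable [set: R] g2 ->
  (forall phi : R -> R, test_function phi ->
     \int[mu]_x (g1 x * phi x) = \int[mu]_x (g2 x * phi x)) ->
  {ae mu, forall x, g1 x = g2 x}.
Proof.
move=> lg1 lg2 g12.
have Iab (a b : R) :
    \int[mu]_(x in `]a, b[) g1 x = \int[mu]_(x in `]a, b[) g2 x.
  have c1 := @cvg_Rintegral_bump g1 a b lg1.
  have c2 : \int[mu]_x (g1 x * bump a b n x) @[n --> \oo] -->
      \int[mu]_(x in `]a, b[) g2 x.
    under eq_cvg do rewrite (g12 _ (bump_test_function _ _ _)).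
    exact: cvg_Rintegral_bump.
  exact: (cvg_unique _ c1 c2).
have FTC (g : R -> R) (x : R) :
    locally_integrable [set: R] g -> lebesgue_pt g x ->
    (fun y => \int[mu]_(t in `]x - 1, y]) g t)^`()%classic x = g x.
  move=> lg gx.
  apply: (@FTC1_lebesgue_pt _ g (BRight (x - 1)) x (x + 1) _ _ _ gx).2.
  - by rewrite ltrDl.
  - apply: (@locally_integrable_itv _ _ (x - 1) (x + 1)) => //.
    exact: subset_itv_oc_cc.
  - by rewrite lte_fin ltrBlDr ltrDl.
have pt1 := lebesgue_differentiation lg1.
have pt2 := lebesgue_differentiation lg2.
apply: ae_imp2 pt1 pt2 => x x1 x2.
rewrite -(FTC g1 x)// -(FTC g2 x)//; congr (derive1 _ x); apply/funext => y.
rewrite -!Rintegral_itv_bndo_bndc ?Iab//.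
all: apply: (@locally_integrable_itv _ _ (x - 1) y) => //.
all: exact: subset_itv_oo_cc.
Qed.

Lemma weak_derive_unique (f g1 g2 : R -> R) :
  is_weak_derive f g1 -> is_weak_derive f g2 ->
  {ae mu, forall x, g1 x = g2 x}.
Proof.
move=> [_ lg1 fg1] [_ lg2 fg2]; apply: test_function_ae_eq => // phi tphi.
by apply: oppr_inj; rewrite -fg1// -fg2.
Qed.
End uniqueness.

(** * Affine changes of variables *)

(** The convention [+oo - +oo = -oo] is compatible with positive factors; so
    the changes of variables below hold for all measurable functions,
    integrable or not. *)
Lemma pmuleBr (R : realDomainType) (a : R) (x y : \bar R) : 0 < a ->
  (a%:E * (x - y) = a%:E * x - a%:E * y)%E.
Proof.
move=> a0; case: x y => [x||] [y||] /=.
all: rewrite ?gt0_muley ?gt0_muleNy ?lte_fin//=.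
by rewrite -EFinM -EFinB mulrBr.
Qed.

Lemma fine_pmule (R : realDomainType) (a : R) (x : \bar R) : 0 < a ->
  fine (a%:E * x)%E = a * fine x.
Proof.
move=> a0; case: x => [x||] //=.
all: by rewrite ?gt0_muley ?gt0_muleNy ?lte_fin//= mulr0.
Qed.

Section affine.
Variables (R : realType) (a b : R).
Hypothesis a0 : 0 < a.
Local Notation mu := (@lebesgue_measure R).
Local Notation T := ((fun x => a * x + b) : R -> measurableTypeR R).

Let anng : {nonneg R} := NngNum (ltW a0).

Lemma continuous_affine : continuous (fun x : R => a * x + b).
Proof.
move=> x; apply: cvgD; last exact: cvg_cst.
by apply: cvgM; [exact: cvg_cst|exact: cvg_id].
Qed.

Lemma measurable_affine : measurable_fun [set: R] T.
Proof. exact: continuous_measurable_fun continuous_affine. Qed.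

Lemma affine_preimage_itv (b1 b2 : bool) (u v : R) :
  T @^-1` [set` Interval (BSide b1 u) (BSide b2 v)] =
  [set` Interval (BSide b1 ((u - b) / a)) (BSide b2 ((v - b) / a))].
Proof.
apply/seteqP; split => x/=; rewrite !in_itv/= => /andP[ux xv]; apply/andP;
  split.
- by rewrite lteif_pdivrMr// mulrC lteifBlDr.
- by rewrite lteif_pdivlMr// mulrC lteifBrDr.
- by rewrite -lteifBlDr mulrC -lteif_pdivrMr.
- by rewrite -lteifBrDr mulrC -lteif_pdivlMr.
Qed.

(** The measure is scaled before it is pushed forward: this way both sides are
    measures on the target line, and they agree on intervals. *)
Lemma lebesgue_measure_affine (A : set R) : measurable A ->
  mu A = pushforward (mscale anng mu) T A.
Proof.
move=> mA; apply: lebesgue_measure_unique => //=.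
  exact: measurable_affine.
move=> _ _ [[u v]] _ <-; rewrite /pushforward affine_preimage_itv /mscale/=.
rewrite !lebesgue_measure_itv/= !lte_fin ltr_pM2r ?invr_gt0// ltrD2r.
case: ifPn => _; last by rewrite mule0.
by rewrite -!EFinB -EFinM; congr EFin; field; rewrite gt_eqF.
Qed.

Lemma ge0_integral_affine (D : set R) (f : R -> \bar R) :
  measurable D -> measurable_fun D f -> (forall x, D x -> 0 <= f x)%E ->
  (\int[mu]_(y in D) f y =
   a%:E * \int[mu]_(x in T @^-1` D) f (a * x + b)%R)%E.
Proof.
move=> mD mf f0.
transitivity (\int[pushforward (mscale anng mu) T]_(y in D) f y)%E.
  apply: eq_measure_integral => [|mT A mA _]; first exact: measurable_affine.
  exact: lebesgue_measure_affine.
rewrite ge0_integral_pushforward//=; last 2 first.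
- exact: measurable_affine.
- by move=> y; rewrite inE; exact: f0.
have mTD : measurable (T @^-1` D).
  by rewrite -[X in measurable X]setTI; exact: measurable_affine.
rewrite ge0_integral_mscale//=.
- apply: (measurable_comp (F := D)) => //.
    by move=> _ [x Dx <-].
  exact: measurable_funTS measurable_affine.
- by move=> x Dx; exact: f0.
Qed.

Lemma integral_affine (D : set R) (f : R -> \bar R) :
  measurable D -> measurable_fun D f ->
  (\int[mu]_(y in D) f y =
   a%:E * \int[mu]_(x in T @^-1` D) f (a * x + b)%R)%E.
Proof.
move=> mD mf; rewrite [LHS]integralE [X in (_ * X)%E]integralE.
rewrite (ge0_integral_affine mD (measurable_funepos mf))//.
rewrite (ge0_integral_affine mD (measurable_funeneg mf))//.
rewrite [RHS](pmuleBr _ _ a0).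
congr (_ * _ - _ * _)%E; apply: eq_integral => x _.
  by rewrite !funeposE.
by rewrite !funenegE.
Qed.

Lemma Rintegral_affine (f : R -> R) : measurable_fun [set: R] f ->
  \int[mu]_y f y = a * \int[mu]_x f (a * x + b).
Proof.
move=> mf; rewrite /Rintegral integral_affine//; last exact/measurable_EFinP.
by rewrite preimage_setT fine_pmule.
Qed.

Lemma ae_affine (P : R -> Prop) :
  {ae mu, forall x, P x} -> {ae mu, forall x, P (a * x + b)}.
Proof.
move=> [N [mN N0 PN]].
have mTN : measurable (T @^-1` N).
  by rewrite -[X in measurable X]setTI; exact: measurable_affine.
exists (T @^-1` N); split => //; last by move=> x; exact: PN.
move: N0; rewrite lebesgue_measure_affine// /pushforward /mscale/=.
by move/eqP; rewrite mule_eq0 eqe gt_eqF//= => /eqP.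
Qed.

Lemma compact_affine_image (K : set R) : compact K -> compact (T @` K).
Proof.
move=> cK; apply: continuous_compact => //.
exact/continuous_subspaceT/continuous_affine.
Qed.

Lemma locally_integrable_affine (f : R -> R) :
  locally_integrable [set: R] f ->
  locally_integrable [set: R] (fun x => f (a * x + b)).
Proof.
move=> [mf oT lf]; split => //.
  exact: (measurableT_comp mf measurable_affine).
move=> K _ cK; have mK := compact_measurable cK.
have cTK := compact_affine_image cK; have mTK := compact_measurable cTK.
have := lf _ (@subsetT _ _) cTK.
rewrite integral_affine//; last first.
  apply/measurable_EFinP; apply: measurableT_comp => //.
  exact: measurable_funTS.
have -> : T @^-1` (T @` K) = K.
  apply/seteqP; split => x/=; last by exists x.
  by move=> [y Ky /addIr /(mulfI (lt0r_neq0 a0)) <-].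
rewrite -[X in (X < _)%E -> _]/(_ * _)%E -lte_pdivlMl//.
by rewrite gt0_muley// lte_fin invr_gt0.
Qed.
End affine.

(** * Weak derivatives under scaling and affine substitution *)

Section weak_derive_affine.
Variable R : realType.
Local Notation mu := (@lebesgue_measure R).

Lemma RintegralpZl (c : R) (f : R -> R) : 0 < c -> measurable_fun [set: R] f ->
  \int[mu]_x (c * f x) = c * \int[mu]_x f x.
Proof.
move=> c0 mf.
have mEf : measurable_fun [set: R] (EFin \o f) by exact/measurable_EFinP.
have -> : \int[mu]_x (c * f x) = fine (c%:E * \int[mu]_x (f x)%:E).
  rewrite /Rintegral; congr fine.
  rewrite [LHS]integralE [X in (_ = _ * X)%E]integralE.
  rewrite [RHS](pmuleBr _ _ c0).
  have -> : (fun x => (c * f x)%:E) = (fun x => c%:E * (EFin \o f) x)%E.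
    by apply/funext => x; rewrite /= EFinM.
  rewrite ge0_funeposM ?ge0_funenegM ?(ltW c0)//.
  rewrite ge0_integralZl_EFin ?(ltW c0)//; last exact: measurable_funepos.
  by rewrite ge0_integralZl_EFin ?(ltW c0)//; exact: measurable_funeneg.
by rewrite fine_pmule.
Qed.

Lemma derive1n_affine (a b : R) (f : R -> R) (k : nat) :
  (forall k (x : R), derivable (derive1n k f) x 1) ->
  derive1n k (fun x => f (a * x + b)) =
  (fun x => a ^+ k * derive1n k f (a * x + b)).
Proof.
move=> sf; elim: k => [|k IH].
  by apply/funext => x; rewrite !derive1n0 mul1r.
apply/funext => x; rewrite derive1nS IH derive1E exprSr -mulrA.
have df : is_derive x 1 (fun x => derive1n k f (a * x + b))
    (a * derive1n k.+1 f (a * x + b)).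
  apply: is_derive_affine; rewrite derive1nS derive1E.
  exact/derivableP/sf.
by rewrite deriveMl ?derive_val.
Qed.

(** The support is contained in the image of the support of [phi] under the
    inverse affine map, and this image is compact. *)
Lemma test_function_affine (a b : R) (phi : R -> R) : 0 < a ->
  test_function phi -> test_function (fun x => phi (a * x + b)).
Proof.
move=> a0 [sphi cphi]; split => [k x|].
  rewrite derive1n_affine//.
  have : is_derive x 1 (fun x => derive1n k phi (a * x + b))
      (a * derive1n k.+1 phi (a * x + b)).
    apply: is_derive_affine; rewrite derive1nS derive1E.
    exact/derivableP/sphi.
  move=> [d _]; exact: derivableM.
have ai0 : 0 < a^-1 by rewrite invr_gt0.
have cK := compact_affine_image (a := a^-1) (b := - (b / a)) cphi.
apply: (subclosed_compact _ cK); first exact: closed_closure.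
rewrite [X in _ `<=` X](closure_id _).1; last first.
  exact: compact_closed (@Rhausdorff R) cK.
apply: closure_subset => x/= phix; exists (a * x + b).
  exact: subset_closure.
by field; rewrite gt_eqF.
Qed.

Lemma locally_integrablepZ (c : R) (h : R -> R) : 0 < c ->
  locally_integrable [set: R] h ->
  locally_integrable [set: R] (fun x => c * h x).
Proof.
move=> c0 [mh oT lh]; split => //; first exact: measurable_funM.
move=> K _ cK; have mK := compact_measurable cK.
under eq_integral do rewrite normrM (gtr0_norm c0) EFinM.
rewrite ge0_integralZl_EFin ?(ltW c0)//.
  by rewrite lte_mul_pinfty ?lee_fin ?(ltW c0)// lh.
apply/measurable_EFinP; apply: measurableT_comp => //.
exact: measurable_funTS.
Qed.

Lemma is_weak_deriveZ (c : R) (f g : R -> R) : 0 < c ->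
  is_weak_derive f g ->
  is_weak_derive (fun x => c * f x) (fun x => c * g x).
Proof.
move=> c0 [lf lg fg].
split; [exact: locally_integrablepZ|exact: locally_integrablepZ|].
move=> phi tphi.
have [mf _ _] := lf; have [mg _ _] := lg.
have mphi := measurable_test_function tphi.
have mdphi : measurable_fun [set: R] (derive1 phi).
  exact: measurable_derive1_test_function tphi.
under eq_Rintegral do rewrite -mulrA.
under [in RHS]eq_Rintegral do rewrite -mulrA.
rewrite RintegralpZl//; last exact: measurable_funM.
rewrite RintegralpZl//; last exact: measurable_funM.
by rewrite fg// mulrN.
Qed.

(** The chain rule.  Every test function is [Phi (a x + b)] for a test
    function [Phi], namely its composition with the inverse map; the
    substitution turns the identity to prove into the one for [f] tested
    against [Phi]. *)
Lemma is_weak_derive_affine (a b : R) (f g : R -> R) : 0 < a ->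
  is_weak_derive f g ->
  is_weak_derive (fun x => f (a * x + b)) (fun x => a * g (a * x + b)).
Proof.
move=> a0 [lf lg fg].
have [mf _ _] := lf; have [mg _ _] := lg.
have lfa := locally_integrable_affine b a0 lf.
have lga := locally_integrable_affine b a0 lg.
split => //; first exact: locally_integrablepZ.
move=> phi tphi.
pose Phi x := phi (a^-1 * x + - (b / a)).
have phiE x : phi x = Phi (a * x + b).
  by rewrite /Phi; congr phi; field; rewrite gt_eqF.
have tPhi : test_function Phi.
  by apply: test_function_affine => //; rewrite invr_gt0.
have mPhi := measurable_test_function tPhi.
have mdPhi := measurable_derive1_test_function tPhi.
have dphiE x : derive1 phi x = a * derive1 Phi (a * x + b).
  rewrite (funext phiE) -[LHS]/(derive1n 1 (fun x => Phi (a * x + b)) x).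
  by rewrite derive1n_affine ?expr1//; case: tPhi.
have -> : \int[mu]_x (f (a * x + b) * derive1 phi x) =
    \int[mu]_y (f y * derive1 Phi y).
  rewrite [RHS](Rintegral_affine b a0); last exact: measurable_funM.
  under eq_Rintegral do rewrite dphiE mulrCA.
  rewrite RintegralpZl//.
  apply: (measurableT_comp (f := fun y => f y * derive1 Phi y)) => //.
    exact: measurable_funM.
  exact: measurable_affine.
rewrite fg//; congr (- _).
rewrite [LHS](Rintegral_affine b a0); last exact: measurable_funM.
under [RHS]eq_Rintegral do rewrite -mulrA phiE.
rewrite RintegralpZl//.
apply: (measurableT_comp (f := fun y => g y * Phi y)) => //.
  exact: measurable_funM.
exact: measurable_affine.
Qed.
End weak_derive_affine.

(** * Functions that are periodic almost everywhere *)

Section periodicity.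
Variable R : realType.
Local Notation mu := (@lebesgue_measure R).

Lemma weak_deriveP (f : R -> R) : weakly_derivable f ->
  is_weak_derive f (weak_derive f).
Proof. by move=> wf; exact: getPex. Qed.

Lemma is_weak_derive_ae_eq (f1 f2 g : R -> R) :
  {ae mu, forall x, f1 x = f2 x} -> locally_integrable [set: R] f2 ->
  is_weak_derive f1 g -> is_weak_derive f2 g.
Proof.
move=> f12 lf2 [lf1 lg fg]; split=> // phi tphi; rewrite -fg//.
have [mf1 _ _] := lf1; have [mf2 _ _] := lf2.
have mdphi := measurable_derive1_test_function tphi.
congr fine; apply: ae_eq_integral => //.
- by apply/measurable_EFinP; exact: measurable_funM.
- by apply/measurable_EFinP; exact: measurable_funM.
- by apply: ae_imp f12 => x f12 _; rewrite f12.
Qed.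

Lemma ae_periodic_natmul (T : Type) (f : R -> T) (n : nat) :
  {ae mu, forall x, f (x + 1) = f x} ->
  {ae mu, forall x, f (x + n%:R) = f x}.
Proof.
move=> f1; elim: n => [|n IH]; first by apply: aeW => x; rewrite addr0.
have := ae_affine n%:R ltr01 f1.
apply: ae_imp2 IH => x <-; rewrite mul1r => <-.
by rewrite -addrA natr1.
Qed.

Lemma ae_periodic_intmul (T : Type) (f : R -> T) (m : int) :
  {ae mu, forall x, f (x + 1) = f x} ->
  {ae mu, forall x, f (x + m%:~R) = f x}.
Proof.
move=> f1; case: (intP m) => [|n|n].
- by apply: aeW => x; rewrite addr0.
- exact: ae_periodic_natmul.
- have := ae_affine (- n.+1%:R) ltr01 (ae_periodic_natmul n.+1 f1).
  by apply: ae_imp => x; rewrite mul1r subrK => ->; rewrite mulrNz.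
Qed.

Lemma ae_forall_int (P : int -> R -> Prop) :
  (forall m, {ae mu, forall x, P m x}) -> {ae mu, forall x, forall m, P m x}.
Proof.
move=> aeP.
have aeP1 := ae_foralln (fun n => aeP (Posz n)).
have aeP2 := ae_foralln (fun n => aeP (Negz n)).
by apply: ae_imp2 aeP1 aeP2 => x h1 h2 [n|n].
Qed.

Lemma ae_neq (c : R) : {ae mu, forall x, x != c}.
Proof.
exists [set c]; split => //; first exact: lebesgue_measure_set1.
by move=> x /= /negP; rewrite negbK => /eqP.
Qed.

(** Almost every [x] is such that all its integer translates avoid the
    exceptional sets, countably many null sets being discarded; the translate
    by minus the integer part of [x] lies in the open unit interval, as
    integers are among the discarded points. *)
Lemma ae_periodic_extend (T : Type) (f : R -> T) (P : T -> Prop) :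
  {ae mu, forall x, f (x + 1) = f x} ->
  {ae mu, forall x, unit_itv R x -> P (f x)} ->
  {ae mu, forall x, P (f x)}.
Proof.
move=> f1 Pf.
have H : {ae mu, forall x, forall m : int, [/\ f (x + m%:~R) = f x,
    unit_itv R (x + m%:~R) -> P (f (x + m%:~R)) & x + m%:~R != 0]}.
  apply: ae_forall_int => m.
  have h1 := ae_periodic_intmul m f1.
  have h2 := ae_affine m%:~R ltr01 Pf.
  have h3 := ae_affine m%:~R ltr01 (ae_neq 0).
  apply: (ae_imp2 _ (ae_imp2 (fun x a b => conj a b) h1 h2) h3) => x [].
  by rewrite mul1r.
apply: ae_imp H => x /(_ (- Num.floor x)) [fx Px x0]; rewrite -fx; apply: Px.
have /andP[lx xl] := floor_itv x; rewrite intrD in xl.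
rewrite /unit_itv/= in_itv/= lt0r x0/= mulrNz subr_ge0 lx/=.
by rewrite ltrBlDr addrC.
Qed.

Lemma measurable_unit_itv : measurable (unit_itv R).
Proof. exact: measurable_itv. Qed.

(** * Norms of periodic functions *)

Lemma Lnorm_onyE (D : set R) (f : R -> R) :
  Lnorm_on D +oo f = ess_sup mu (fun x => `|(f \_ D) x|%:E).
Proof.
rewrite /Lnorm_on unlock ifT// (@lt_le_trans _ _ (mu `[0, 1]))//.
  by rewrite lebesgue_measure_itv/= lte01 oppr0 adde0 lte01.
by apply: le_measure; rewrite ?inE.
Qed.

Lemma Lnorm_ony_periodic (f : R -> R) :
  {ae mu, forall x, f (x + 1) = f x} ->
  {ae mu, forall x, (`|f x|%:E <= Lnorm_on (unit_itv R) +oo f)%E}.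
Proof.
move=> f1.
pose P (y : R) := (`|y|%:E <= Lnorm_on (unit_itv R) +oo f)%E.
apply: (ae_periodic_extend (P := P) f1); rewrite /P.
rewrite Lnorm_onyE.
have := ess_sup_ge mu (fun x => `|(f \_ (unit_itv R)) x|%:E).
by apply: ae_imp => x + x01; rewrite patchE mem_set.
Qed.

Lemma measurable_sqr_norm (h : R -> R) : measurable_fun [set: R] h ->
  measurable_fun [set: R] (fun x => (`|h x| ^+ 2)%:E).
Proof.
move=> mh; apply/measurable_EFinP.
by apply: measurable_funX; exact: measurableT_comp.
Qed.

Lemma Lnorm_on2E (D : set R) (f : R -> R) :
  measurable D -> measurable_fun [set: R] f ->
  Lnorm_on D 2%:E f = ((\int[mu]_(x in D) (`|f x| ^+ 2)%:E) `^ 2^-1)%E.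
Proof.
move=> mD mf; rewrite /Lnorm_on unlock; congr (_ `^ _)%E.
rewrite [RHS]integral_mkcond; apply: eq_integral => x _.
rewrite /= !patchE; case: ifPn => _.
  by rewrite powR_mulrn.
by rewrite /= normr0 powR0// pnatr_eq0.
Qed.

Lemma Lnorm_on_ae_eq (D : set R) (f g : R -> R) :
  measurable D -> measurable_fun [set: R] f -> measurable_fun [set: R] g ->
  {ae mu, forall x, f x = g x} -> Lnorm_on D 2%:E f = Lnorm_on D 2%:E g.
Proof.
move=> mD mf mg fg; rewrite !Lnorm_on2E//; congr (_ `^ _)%E.
apply: ae_eq_integral => //.
- exact: measurable_funTS (measurable_sqr_norm mf).
- exact: measurable_funTS (measurable_sqr_norm mg).
- by apply: ae_imp fg => x fg _; rewrite fg.
Qed.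

Lemma integral_periodic (G : R -> \bar R) (k : nat) :
  measurable_fun [set: R] G -> (forall x, 0 <= G x)%E ->
  {ae mu, forall x, G (x + 1) = G x} ->
  (\int[mu]_(x in `]0%R, k%:R[) G x =
   k%:R%:E * \int[mu]_(x in unit_itv R) G x)%E.
Proof.
move=> mG G0 G1.
have co (u v : R) :
    (\int[mu]_(x in `]u, v[) G x = \int[mu]_(x in `[u, v[) G x)%E.
  by rewrite [RHS]integral_itv_bndoo//; exact: measurable_funTS.
rewrite co; elim: k => [|k IH].
  by rewrite set_itvco0 integral_set0 mul0e.
rewrite (@itv_bndbnd_setU _ _ _ (BLeft k%:R)) ?bnd_simp ?ler_nat//.
rewrite ge0_integral_setU//=; last 2 first.
- exact: measurable_funTS.
- apply/disj_setPS => x [/=]; rewrite !in_itv/= => /andP[_ xk] /andP[kx _].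
  by move: (lt_le_trans xk kx); rewrite ltxx.
rewrite IH -natr1 EFinD ge0_muleDl ?lee_fin// mul1e; congr (_ + _)%E.
rewrite -co (integral_affine k%:R ltr01)//; last exact: measurable_funTS.
rewrite mul1e affine_preimage_itv//= subrr mul0r addrAC subrr add0r divr1.
apply: ae_eq_integral => //.
- apply: measurable_funTS; apply: (measurableT_comp mG).
  exact: measurable_affine.
- exact: measurable_funTS.
- by apply: ae_imp (ae_periodic_natmul k G1) => x + _; rewrite mul1r.
Qed.

(** Substituting [y = k x] gives [1/k] times the integral over [(0, k)], which
    consists of [k] periods. *)
Lemma integral_dilation_periodic (G : R -> \bar R) (k : nat) : (0 < k)%N ->
  measurable_fun [set: R] G -> (forall x, 0 <= G x)%E ->
  {ae mu, forall x, G (x + 1) = G x} ->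
  (\int[mu]_(x in unit_itv R) G (k%:R * x + 0)%R =
   \int[mu]_(x in unit_itv R) G x)%E.
Proof.
move=> k0 mG G0 G1; have k0' : 0 < k%:R :> R by rewrite ltr0n.
have := integral_periodic k mG G0 G1.
rewrite (ge0_integral_affine 0 k0')//; last exact: measurable_funTS.
rewrite affine_preimage_itv// !subr0 mul0r divff ?gt_eqF//.
move=> /(congr1 (fun z => (k%:R^-1%:E * z)%E)).
by rewrite !muleA -EFinM mulVf ?gt_eqF// !mul1e.
Qed.

Lemma Lnorm_on2_dilation (c : R) (g : R -> R) (k : nat) : 0 < c -> (0 < k)%N ->
  measurable_fun [set: R] g -> {ae mu, forall x, g (x + 1) = g x} ->
  (Lnorm_on (unit_itv R) 2%:E (fun x => c * g (k%:R * x + 0))%R =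
   c%:E * Lnorm_on (unit_itv R) 2%:E g)%E.
Proof.
move=> c0 k0 mg g1; have k0' : 0 < k%:R :> R by rewrite ltr0n.
have mgk : measurable_fun [set: R] (fun x => g (k%:R * x + 0)).
  by apply: (measurableT_comp mg); exact: measurable_affine.
have mI := measurable_unit_itv.
rewrite !Lnorm_on2E//; last exact: measurable_funM.
under eq_integral do rewrite normrM (gtr0_norm c0) exprMn EFinM.
rewrite ge0_integralZl_EFin ?sqr_ge0//; last first.
  exact: measurable_funTS (measurable_sqr_norm mgk).
rewrite (@integral_dilation_periodic (fun x => (`|g x| ^+ 2)%:E))//;
    last 2 first.
- exact: measurable_sqr_norm.
- by apply: ae_imp g1 => x ->.
rewrite poweRM; [|by rewrite lee_fin sqr_ge0|]; last first.
  by apply: integral_ge0 => x _; rewrite lee_fin exprn_ge0.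
congr (_ * _)%E; rewrite poweR_EFin; congr EFin.
by rewrite -powR_mulrn ?(ltW c0)// -powRrM mulfV// powRr1// ltW.
Qed.

(** The unit translate of [g] is a weak derivative of the unit translate of
    [f], hence of [f] itself, so that it is [g] by uniqueness. *)
Lemma weak_derive_periodic (f g : R -> R) :
  {ae mu, forall x, f (x + 1) = f x} -> is_weak_derive f g ->
  {ae mu, forall x, g (x + 1) = g x}.
Proof.
move=> f1 fg; have [lf _ _] := fg.
have fg1 := is_weak_derive_affine 1 ltr01 fg.
have : is_weak_derive f (fun x => 1 * g (1 * x + 1)).
  apply: is_weak_derive_ae_eq fg1 => //.
  by apply: ae_imp f1 => x; rewrite mul1r.
move=> /(weak_derive_unique fg); apply: ae_imp => x ->.
by rewrite !mul1r.
Qed.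

(** [L2loc] speaks of compact sets: the closed unit interval is one, and it
    differs from the open one by a null set. *)
Lemma Lnorm_on2_L2loc (g : R -> R) : measurable_fun [set: R] g -> L2loc g ->
  (Lnorm_on (unit_itv R) 2%:E g < +oo)%E.
Proof.
move=> mg /(_ _ (@segment_compact R 0 1)) /sub_Lfun_finLfun.
rewrite inE /finite_norm/= => h; have mI := measurable_unit_itv.
rewrite [X in (X < _)%E](_ : _ = Lnorm_on `[0, 1] 2%:E g)//.
rewrite !Lnorm_on2E//; congr (_ `^ _)%E; rewrite [RHS]integral_itv_bndoo//.
exact: measurable_funTS (measurable_sqr_norm mg).
Qed.

End periodicity.

(** * The oscillating sequence *)

Lemma powR_cvg_pinfty (R : realType) (eps : nat -> R) (s : R) :
  (forall n, 0 < eps n) -> eps @ \oo --> (0 : R) -> s < 0 ->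
  eps n `^ s @[n --> \oo] --> +oo.
Proof.
move=> eps0 ceps s0; apply/cvgryPge => A.
(* The threshold [B `^ s^-1] is where [x `^ s] equals [B]; taking [B >= 1]
   makes it positive. *)
pose B := Num.max 1 A; have B0 : 0 < B by rewrite lt_max ltr01.
have C0 : 0 < B `^ s^-1 by rewrite powR_gt0.
have sn0 : 0 <= - s by rewrite oppr_ge0 ltW.
near=> n.
rewrite (@le_trans _ _ B)//; first by rewrite le_max lexx orbT.
rewrite -[s]opprK powRN -[leLHS]invrK lef_pV2 ?posrE ?invr_gt0 ?powR_gt0//.
have -> : B^-1 = (B `^ s^-1) `^ (- s).
  by rewrite -powRrM mulrN mulVf ?lt_eqF// powR_inv1// ltW.
apply: ge0_ler_powR => //; rewrite ?nnegrE ?(ltW C0) ?(ltW (eps0 _))//.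
near: n; have /cvgrPdist_le/(_ _ C0) := ceps.
by apply: filterS => n; rewrite sub0r normrN gtr0_norm.
Unshelve. all: by end_near. Qed.

Theorem proposition2p1 (R : realType) (psi : R -> R)
    (psi_H1per : H1per psi)
    (psi_Loo : Lfun_on (unit_itv R) +oo psi)
    (dpsi_gt0 : (0 < Lnorm_on (unit_itv R) 2%:E (weak_derive psi))%E)
    (eps r : nat -> R)
    (eps_gt0 : forall n, 0 < eps n)
    (eps_noninc : forall m n, (m <= n)%N -> eps n <= eps m)
    (eps_cvg0 : eps @ \oo --> (0 : R))
    (eps_inv : forall n, exists k : nat, (eps n)^-1 = k%:R)
    (r_gt0 : forall n, 0 < r n)
    (r_cvg0 : r @ \oo --> (0 : R))
    (Rn : nat -> R -> R)
    (RnE : forall n x, Rn n x = r n * psi (x / eps n)) :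
  let normLoo n := Lnorm_on [set: R] +oo (Rn n) in
  let normL2d n := Lnorm_on (unit_itv R) 2%:E (weak_derive (Rn n)) in
  (forall n, weakly_derivable (Rn n)) /\
  (forall n,
    (normLoo n <= (r n)%:E * Lnorm_on (unit_itv R) +oo psi)%E /\
    normL2d n =
      ((r n / eps n)%:E * Lnorm_on (unit_itv R) 2%:E (weak_derive psi))%E) /\
  (normLoo @ \oo --> 0%E) /\
  (asymp (EFin \o r) (EFin \o eps) -> is_O normL2d (fun=> 1%E)) /\
  ((r n / eps n) @[n --> \oo] --> +oo -> normL2d @ \oo --> +oo%E) /\
  (forall alpha : R, 0 < alpha -> alpha < 1 ->
    (forall n, r n = eps n `^ alpha) ->
    [/\ is_O normLoo (fun n => (eps n `^ alpha)%:E),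
        asymp normL2d (fun n => (eps n `^ (alpha - 1))%:E),
        eps n `^ (alpha - 1) @[n --> \oo] --> +oo &
        normL2d @ \oo --> +oo%E]).
Proof.
move=> normLoo normL2d.
have [[_ wd L2d] psi1] := psi_H1per.
set g := weak_derive psi in L2d dpsi_gt0 *.
have psi_g : is_weak_derive psi g by exact: weak_deriveP.
have g1 := weak_derive_periodic psi1 psi_g.
have [_ lg _] := psi_g; have [mg _ _] := lg.
(* The zero summand keeps the affine form of the chain rule. *)
have Rn_weak n : is_weak_derive (Rn n)
    (fun x => r n * ((eps n)^-1 * g ((eps n)^-1 * x + 0))).
  rewrite (_ : Rn n = (fun x => r n * psi ((eps n)^-1 * x + 0))).
    apply: is_weak_deriveZ => //.
    by apply: is_weak_derive_affine; rewrite ?invr_gt0.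
  by apply/funext => x; rewrite RnE addr0 (mulrC x).
have wRn n : weakly_derivable (Rn n) by eexists; exact: Rn_weak.
have Loo n : (normLoo n <= (r n)%:E * Lnorm_on (unit_itv R) +oo psi)%E.
  rewrite /normLoo Lnorm_onyE patch_setT; apply/ess_supP.
  have ein0 : 0 < (eps n)^-1 by rewrite invr_gt0.
  apply: ae_imp (ae_affine 0 ein0 (Lnorm_ony_periodic psi1)) => x.
  rewrite addr0 RnE normrM gtr0_norm// EFinM (mulrC x) => h.
  by rewrite lee_pmul2l ?lte_fin.
have L2 n : normL2d n = ((r n / eps n)%:E * Lnorm_on (unit_itv R) 2%:E g)%E.
  have [k ek] := eps_inv n.
  have k0 : (0 < k)%N by rewrite -(ltr0n R) -ek invr_gt0.
  have rk0 : 0 < r n / eps n by rewrite divr_gt0.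
  rewrite -(Lnorm_on2_dilation rk0 k0 mg g1) -ek.
  have [_ [mw _ _] _] := weak_deriveP (wRn n).
  have [_ [mR _ _] _] := Rn_weak n.
  have e : (fun x => r n / eps n * g ((eps n)^-1 * x + 0)) =
      (fun x => r n * ((eps n)^-1 * g ((eps n)^-1 * x + 0))).
    by apply/funext => x; rewrite mulrA.
  rewrite e; apply: Lnorm_on_ae_eq => //; first exact: measurable_unit_itv.
  exact: weak_derive_unique (weak_deriveP (wRn n)) (Rn_weak n).
have [m m0 mE] : exists2 m : R, 0 <= m & Lnorm_on (unit_itv R) +oo psi = m%:E.
  have : (Lnorm_on (unit_itv R) +oo psi < +oo)%E.
    by move/sub_Lfun_finLfun : psi_Loo; rewrite inE.
  have : (0 <= Lnorm_on (unit_itv R) +oo psi)%E by exact: Lnorm_ge0.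
  by case: (Lnorm_on _ _ _) => [m||]//; rewrite lee_fin => m0 _; exists m.
have [N N0 NE] : exists2 N : R, 0 < N & Lnorm_on (unit_itv R) 2%:E g = N%:E.
  have := Lnorm_on2_L2loc mg L2d.
  move: dpsi_gt0; case: (Lnorm_on _ _ _) => [N||]//.
  by rewrite lte_fin => N0 _; exists N.
have L2E n : normL2d n = (r n / eps n * N)%:E by rewrite L2 NE EFinM.
have LooE n : (normLoo n <= (r n * m)%:E)%E by rewrite EFinM -mE.
have L2_cvg : (r n / eps n) @[n --> \oo] --> +oo -> normL2d @ \oo --> +oo%E.
  move=> rey; rewrite (funext L2E : normL2d = _).
  apply/cvgeryP/cvgryPge => A; move/cvgryPge/(_ (A / N)) : rey.
  by apply: filterS => n; rewrite ler_pdivrMr.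
split=> //; split.
  by move=> n; split.
split.
  apply: (squeeze_cvge (f := cst 0%E) (h := fun n => (r n * m)%:E)).
  - by apply: nearW => n; rewrite LooE andbT; exact: Lnorm_ge0.
  - exact: cvg_cst.
  - apply: cvg_EFin; first exact: nearW.
    by rewrite -(mul0r m); apply: cvgMl.
split.
  move=> [c [C [c0 cC reps]]]; exists (C * N).
    by rewrite mulr_gt0// (lt_le_trans c0).
  move=> n; have [_] := reps n; rewrite L2E mule1 /= -EFinM !lee_fin => rC.
  by rewrite ler_wpM2r ?(ltW N0)// ler_pdivrMr.
split=> // alpha a0 a1 rE.
have reE n : r n / eps n = eps n `^ (alpha - 1).
  by rewrite powRB ?rE ?powRr1 ?(ltW (eps_gt0 n))// lt_eqF.
have ey : eps n `^ (alpha - 1) @[n --> \oo] --> +oo.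
  by apply: powR_cvg_pinfty => //; rewrite subr_lt0.
split=> //.
- exists (m + 1); first by rewrite ltr_wpDl.
  move=> n; rewrite (le_trans (LooE n))// -EFinM lee_fin -rE mulrC.
  by rewrite ler_wpM2r ?lerDl// ltW.
- exists N, N; split=> // n.
  by rewrite L2E reE -EFinM mulrC lexx.
- by apply: L2_cvg; under eq_cvg do rewrite reE.
Qed.
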